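(* $\mathcal{NGSM}\cap\mathcal{NMSO}_{\mathrm{ed}}=\mathcal{NGSM}_{\mathrm{fv}}$.
   Context: A 2gsm is $M=(Q,\Sigma_1,\Sigma_2,\delta,q_{in},q_f)$ with finite state set $Q$ and instructions $(p,\sigma,q_1,\alpha_1,\epsilon_1,q_0,\alpha_0,\epsilon_0)$, $p\neq q_f$, $\sigma\in\Sigma_1\cup\{\vdash,\dashv\}$, $\alpha_i\in\Sigma_2^*$, $\epsilon_i\in\{-1,0,+1\}$. On input $w$ the read-only tape is $\vdash w\dashv$ (positions $0..|w|+1$); start in $q_{in}$ at position 0; in state $p$ any instruction starting with $p$ may be executed: if the scanned symbol is $\sigma$, go to $q_1$, append $\alpha_1$ to the one-way output tape and move by $\epsilon_1$, else do the same with $(q_0,\alpha_0,\epsilon_0)$; the head may not leave the tape. $M$ realizes the relation of all $(w,z)$ such that some computation reaches $q_f$ having written $z$. A computation is $k$-visiting if each tape position is visited at most $k$ times; $M$ is finite visit if for some $k$ every pair in its relation has a $k$-visiting successful computation. $\mathcal{NGSM}$: transductions realized by 2gsm's; $\mathcal{NGSM}_{\mathrm{fv}}$: those realized by finite visit 2gsm's. Graphs are $(V,E,\mathrm{lab})$ with $E\subseteq V\times\Gamma\times V$, $\mathrm{lab}:V\to\Sigma$; monadic second-order logic on graphs has node and node-set variables and atomic formulas $\mathrm{lab}_\sigma(x)$, $\mathrm{edge}_\gamma(x,y)$, $x=y$, $x\in X$. A nondeterministic mso definable graph transduction is given by a domain formula $\varphi_{\mathrm{dom}}$, a finite copy set $C$,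 node formulas $\varphi^c_\sigma(x)$ and edge formulas $\varphi^{c_1,c_2}_\gamma(x,y)$, with common free node-set variables (parameters); for each input $g$ and assignment of node sets to the parameters satisfying $\varphi_{\mathrm{dom}}$, the output has nodes $(u,c)$ for which exactly one $\sigma$ satisfies $\varphi^c_\sigma(u)$ (labelled $\sigma$) and edges $((u,c_1),\gamma,(v,c_2))$ between such nodes iff $\varphi^{c_1,c_2}_\gamma(u,v)$; the transduction is the relation of all such pairs. For $w$ of length $k$, $\mathrm{ed}(w)$ has $k+1$ unlabelled nodes forming a path whose edges are labelled by the letters of $w$; $\mathcal{NMSO}_{\mathrm{ed}}$ is the family of string transductions $m$ such that $\{(\mathrm{ed}(w),\mathrm{ed}(z))\mid(w,z)\in m\}$ is a nondeterministic mso definable graph transduction. *)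

(* Defs.v *)
From Stdlib Require List.
From mathcomp Require Import all_boot.
Set Implicit Arguments. Unset Strict Implicit. Unset Printing Implicit Defensive.

Inductive tape_sym (S : Type) := LEnd | REnd | Sym of S.
Arguments LEnd {S}. Arguments REnd {S}.

Inductive dir := Left | Stay | Right.

Record instr (Q S1 S2 : Type) := Instr {
  i_p : Q; i_sym : tape_sym S1;
  i_q1 : Q; i_a1 : seq S2; i_d1 : dir;
  i_q0 : Q; i_a0 : seq S2; i_d0 : dir }.

Record gsm (S1 S2 : Type) := Gsm {
  gQ : finType;
  gdelta : seq (instr gQ S1 S2);
  gqin : gQ;
  gqf : gQ;
  gwf : all (fun ins => i_p ins != gqf) gdelta   (* p <> q_f *) }.

(* symbol at position i of the tape |- w -| (positions 0 .. |w|+1) *)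
Definition scan (S : Type) (w : seq S) (i : nat) : tape_sym S :=
  match i with
  | 0 => LEnd
  | k.+1 => match drop k w with a :: _ => Sym a | [::] => REnd end
  end.

Definition move (n : nat) (i : nat) (d : dir) (j : nat) : Prop :=
  j <= n.+1 /\
  match d with Left => j.+1 = i | Stay => j = i | Right => j = i.+1 end.

Section GsmSem.
Variables (S1 S2 : Type) (M : gsm S1 S2) (w : seq S1).

Definition config := (gQ M * nat)%type.

Definition step (c c' : config) (alpha : seq S2) : Prop :=
  exists2 ins, List.In ins (gdelta M) &
   i_p ins = c.1 /\
   ((scan w c.2 = i_sym ins /\ c'.1 = i_q1 ins /\ alpha = i_a1 ins
       /\ move (size w) c.2 (i_d1 ins) c'.2)
    \/
    (scan w c.2 <> i_sym ins /\ c'.1 = i_q0 ins /\ alpha = i_a0 ins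
       /\ move (size w) c.2 (i_d0 ins) c'.2)).

Inductive run : config -> seq config -> seq S2 -> Prop :=
| run_end c : c.1 = gqf M -> run c [:: c] [::]
| run_step c c' alpha cs z :
    step c c' alpha -> run c' cs z -> run c (c :: cs) (alpha ++ z).

Definition succ_comp (cs : seq config) (z : seq S2) : Prop :=
  run (gqin M, 0) cs z.

Definition k_visiting (k : nat) (cs : seq config) : Prop :=
  forall i : nat, count (fun c : config => c.2 == i) cs <= k.

End GsmSem.
Arguments step {S1 S2} M w c c' alpha.
Arguments run {S1 S2} M w _ _ _.
Arguments succ_comp {S1 S2} M w cs z.
Arguments k_visiting {S1 S2} M k cs.

Definition gsm_rel (S1 S2 : Type) (M : gsm S1 S2) (w : seq S1) (z : seq S2)
  : Prop := exists cs, succ_comp M w cs z.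

Definition finite_visit (S1 S2 : Type) (M : gsm S1 S2) : Prop :=
  exists k, forall w z, gsm_rel M w z ->
    exists cs, succ_comp M w cs z /\ k_visiting M k cs.

Definition transduction (S1 S2 : Type) := seq S1 -> seq S2 -> Prop.

Definition NGSM (S1 S2 : finType) (m : transduction S1 S2) : Prop :=
  exists M : gsm S1 S2, forall w z, m w z <-> gsm_rel M w z.

Definition NGSM_fv (S1 S2 : finType) (m : transduction S1 S2) : Prop :=
  exists M : gsm S1 S2, finite_visit M /\ forall w z, m w z <-> gsm_rel M w z.

Record graph (Sg Gm : Type) := Graph {
  gV :> finType;
  gE : gV -> Gm -> gV -> bool;
  glab : gV -> Sg }.
Arguments gE {Sg Gm} g _ _ _.
Arguments glab {Sg Gm} g _.
Arguments Graph {Sg Gm} gV gE glab.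

Definition graph_iso (Sg Gm : Type) (g h : graph Sg Gm) : Prop :=
  exists f : gV g -> gV h, bijective f /\
    (forall v, glab h (f v) = glab g v) /\
    (forall u e v, gE h (f u) e (f v) = gE g u e v).

Inductive mso (Sg Gm : Type) :=
| MLab of Sg & nat
| MEdge of Gm & nat & nat
| MEq of nat & nat
| MIn of nat & nat
| MNot of mso Sg Gm
| MAnd of mso Sg Gm & mso Sg Gm
| MExN of nat & mso Sg Gm
| MExS of nat & mso Sg Gm.

Section MsoSem.
Variables (Sg Gm : eqType) (g : graph Sg Gm).

Fixpoint sat (nu : nat -> option (gV g)) (rho : nat -> {set gV g})
    (f : mso Sg Gm) : bool :=
  match f with
  | MLab s x => if nu x is Some v then glab g v == s else false
  | MEdge e x y => if nu x is Some u then if nu y is Some v then gE g u e v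
                   else false else false
  | MEq x y => if nu x is Some u then if nu y is Some v then u == v
               else false else false
  | MIn x X => if nu x is Some v then v \in rho X else false
  | MNot f1 => ~~ sat nu rho f1
  | MAnd f1 f2 => sat nu rho f1 && sat nu rho f2
  | MExN x f1 =>
      [exists v : gV g, sat (fun n => if n == x then Some v else nu n) rho f1]
  | MExS X f1 =>
      [exists S : {set gV g}, sat nu (fun n => if n == X then S else rho n) f1]
  end.

End MsoSem.

(* nondeterministic mso graph transducer: domain formula, copy set C,
   node formulas phi^c_sigma(x) (x = variable 0), edge formulas
   phi^{c1,c2}_gamma(x,y) (x = variable 0, y = variable 1); all free
   node-set variables are parameters. *)
Record msot (Si Gi So Go : Type) := Msot {
  mC : finType;
  mdom : mso Si Gi;
  mnode : mC -> So -> mso Si Gi;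
  medge : mC -> mC -> Go -> mso Si Gi }.

Section MsotSem.
Variables (Si Gi : eqType) (So Go : finType) (T : msot Si Gi So Go)
          (g : graph Si Gi) (rho : nat -> {set gV g}).

Definition env1 (u : gV g) : nat -> option (gV g) := fun _ => Some u.
Definition env2 (u v : gV g) : nat -> option (gV g) :=
  fun n => if n == 0 then Some u else Some v.

Definition out_node (p : (gV g * mC T * So)%type) : bool :=
  [forall t : So, sat (env1 p.1.1) rho (mnode p.1.2 t) == (t == p.2)].

Definition out_V : finType := {p : (gV g * mC T * So)%type | out_node p}.

Definition out_graph : graph So Go :=
  Graph out_V
    (fun p e q => sat (env2 (val p).1.1 (val q).1.1) rho
                      (medge (val p).1.2 (val q).1.2 e))
    (fun p => (val p).2).

End MsotSem.

Definition msot_rel (Si Gi : eqType) (So Go : finType) (T : msot Si Gi So Go)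
  (g : graph Si Gi) (h : graph So Go) : Prop :=
  exists rho : nat -> {set gV g},
    sat (fun _ => None) rho (mdom T) /\ graph_iso (out_graph T rho) h.

(* ed(w): path on |w|+1 unlabelled nodes, edges labelled by letters of w *)
Definition ed (S : eqType) (w : seq S) : graph unit S :=
  Graph ('I_(size w).+1 : finType)
    (fun i a j => [exists k : 'I_(size w),
        [&& val i == val k, val j == (val k).+1 & tnth (in_tuple w) k == a]]
        )
    (fun _ => tt).

Definition NMSO_ed (S1 S2 : finType) (m : transduction S1 S2) : Prop :=
  exists T : msot unit S1 unit S2,
    forall (g : graph unit S1) (h : graph unit S2),
      msot_rel T g h <->
      exists w z, m w z /\ graph_iso g (ed w) /\ graph_iso h (ed z).

(* Main.v *)
(* If the inputs of [m] have boundedly long outputs, as they do both for a finite visit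
   machine and for an mso definable [m], then every pair realized by a 2gsm is realized by
   a computation that repeats no configuration: a loop writing nothing can be cut out, and
   a loop writing something could be pumped. Such a computation visits a position at most
   once per state, which gives the inclusion from left to right.

   Conversely, a computation without repeated configurations follows a memoryless strategy
   that fixes an instruction for each state and position. Node-set parameters encode an
   arbitrary strategy; under it the configurations form a deterministic graph, definable on
   finitely many copies of [ed w], in which the computation is a path. The output nodes are
   the vertices of this path that write a letter, plus the final one, and output edges skip
   over the silent vertices; reachability is expressed by quantifying over closed sets. *)
Require Import Defs.
From mathcomp Require Import all_boot.
Set Implicit Arguments. Unset Strict Implicit. Unset Printing Implicit Defensive.

(** * Cutting loops *)

Section Runs.
Variables (S1 S2 : Type) (M : gsm S1 S2) (w : seq S1).
Implicit Types (c d : config M) (cs : seq (config M)) (z : seq S2).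

(** The list contains the start [c] but not the end [d], so a segment is glued in front of a run
    from [d] by plain concatenation. *)
Inductive segment : config M -> seq (config M) -> config M -> seq S2 -> Prop :=
| segment_nil c : segment c [::] c [::]
| segment_cons c c' d alpha cs z :
    step M w c c' alpha -> segment c' cs d z ->
    segment c (c :: cs) d (alpha ++ z).

Lemma segment_run c cs d z ds y :
  segment c cs d z -> run M w d ds y -> run M w c (cs ++ ds) (z ++ y).
Proof.
elim=> {c cs d z} [c|c c' d alpha cs z st _ IH] //= rd.
by rewrite -catA; apply: run_step st (IH rd).
Qed.

Lemma run_split c cs z cs1 d cs2 :
  run M w c cs z -> cs = cs1 ++ d :: cs2 ->
  exists z1 z2, [/\ z = z1 ++ z2, segment c cs1 d z1 & run M w d (d :: cs2) z2].
Proof.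
move=> r; elim: r cs1 => {c cs z} [c cf|c c' alpha cs z st r IH] [|x cs1] /=.
- by case=> <- <-; exists [::], [::]; split=> //; [exact: segment_nil|exact: run_end].
- by case: cs1.
- case=> <- <-; exists [::], (alpha ++ z); split=> //; first exact: segment_nil.
  exact: run_step st r.
case=> <- /IH[z1 [z2 [-> sg r2]]].
exists (alpha ++ z1), z2; rewrite catA; split=> //.
exact: segment_cons st sg.
Qed.

Lemma run_pump c cs z y ds n :
  segment c cs c z -> run M w c ds y ->
  exists cs', run M w c cs' (flatten (nseq n z) ++ y).
Proof.
move=> sg r; elim: n => [|n [cs' IH]] /=; first by exists ds.
by exists (cs ++ cs'); rewrite -catA; apply: segment_run sg IH.
Qed.

Lemma not_uniq_split (T : eqType) (s : seq T) :
  ~~ uniq s -> exists x s1 s2 s3, s = s1 ++ x :: s2 ++ x :: s3.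
Proof.
elim: s => //= x s IH; rewrite negb_and negbK => /orP[|/IH].
  by case/splitPr=> s1 s2; exists x, [::], s1, s2.
by case=> y [s1 [s2 [s3 ->]]]; exists y, (x :: s1), s2, s3.
Qed.

Lemma bounded_simple_run (B : nat) z :
  (forall z', gsm_rel M w z' -> size z' <= B) -> gsm_rel M w z ->
  exists cs, succ_comp M w cs z /\ uniq (cs : seq (gQ M * nat)).
Proof.
move=> bnd [cs]; have [n] := ubnP (size cs); elim: n cs => // n IH cs.
rewrite ltnS => le_n r.
case: (boolP (uniq (cs : seq (gQ M * nat)))) => [ucs|]; first by exists cs.
case/not_uniq_split=> d [s1 [s2 [s3 def_cs]]].
have [z1 [z2 [def_z sg1 r2]]] := run_split r def_cs.
have [z3 [z4 [def_z2 sg2 r3]]] := @run_split _ _ _ (d :: s2) d s3 r2 erefl.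
(* If the loop at [d] writes nothing, removing it keeps the output and shortens the computation. *)
case: z3 def_z2 sg2 => [|a z3] def_z2 sg2; subst.
  apply: (IH (s1 ++ d :: s3)).
    by apply: leq_trans le_n; rewrite !size_cat /= size_cat /= ltn_add2l !ltnS addnS ltnS leq_addl.
  exact: segment_run sg1 r3.
(* Otherwise each round of the loop writes at least one letter, so [B.+1] rounds give an output for
   the same [w] longer than [B]. *)
have [cs' rp] := run_pump B.+1 sg2 r3.
have /bnd: gsm_rel M w (z1 ++ (flatten (nseq B.+1 (a :: z3)) ++ z4)).
  by exists (s1 ++ cs'); apply: segment_run sg1 rp.
rewrite !size_cat size_flatten /shape map_nseq sumn_nseq => le_B; exfalso.
have: B.+1 <= B; last by rewrite ltnn.
apply: leq_trans le_B; rewrite addnCA; apply: leq_trans (leq_addr _ _). 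
by rewrite -mulnS leq_pmull.
Qed.

Lemma uniq_k_visiting (cs : seq (gQ M * nat)) :
  uniq cs -> k_visiting M #|gQ M| cs.
Proof.
move=> ucs i; rewrite -size_filter.
rewrite -(size_map fst) -(card_uniqP _) ?max_card //.
rewrite map_inj_in_uniq ?filter_uniq //.
by move=> [q j] [q' j']; rewrite !mem_filter /= => /andP[/eqP-> _] /andP[/eqP-> _] ->.
Qed.

Lemma run_positions c cs z : c.2 <= (size w).+1 -> run M w c cs z ->
  all (fun d => d.2 < (size w).+2) cs.
Proof.
move=> le_c r; elim: r le_c => {c cs z} [c _|c c' alpha cs z st _ IH] le_c /=.
  by rewrite ltnS le_c.
by rewrite ltnS le_c IH //; case: st => ins _ [_ [|][_ [_ [_ []]]]].
Qed.

Lemma size_k_visiting k n (cs : seq (config M)) :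
  k_visiting M k cs -> all (fun d : config M => d.2 < n) cs -> size cs <= n * k.
Proof.
move=> kv lt_n; pose cnt m := count (fun d : config M => d.2 < m) cs.
suff le_cnt m : cnt m <= m * k by move: lt_n; rewrite all_count => /eqP <-; exact: le_cnt.
elim: m => [|m IH]; first by rewrite /cnt (@eq_count _ _ pred0) ?count_pred0.
have -> : cnt m.+1 = count (fun d : config M => d.2 == m) cs + cnt m.
  rewrite /cnt -count_predUI [X in _ + X](@eq_count _ _ pred0) ?count_pred0 ?addn0.
    by apply: eq_count => d /=; rewrite ltnS leq_eqVlt.
  by move=> d /=; case: ltngtP.
by rewrite mulSn leq_add.
Qed.

Definition output_bound := \max_(i <- gdelta M) maxn (size (i_a1 i)) (size (i_a0 i)).

Lemma instr_output_bound ins : List.In ins (gdelta M) ->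
  size (i_a1 ins) <= output_bound /\ size (i_a0 ins) <= output_bound.
Proof.
move=> Hin; apply/andP; rewrite -geq_max /output_bound.
elim: (gdelta M) Hin => //= i s IH [->|/IH le_s]; rewrite big_cons leq_max ?leqnn //.
by rewrite le_s orbT.
Qed.

Lemma run_output_bound c cs z : run M w c cs z -> size z <= size cs * output_bound.
Proof.
elim=> {c cs z} // c c' alpha cs z [ins /instr_output_bound[le1 le0] [_ st]] _ IH.
by rewrite size_cat mulSn leq_add //; case: st => -[_ [_ [-> _]]].
Qed.

(** There are [(size w).+2] positions, each visited at most [k] times, and every step writes at most
    [output_bound] letters. *)
Lemma finite_visit_bounded : finite_visit M ->
  exists B, forall z, gsm_rel M w z -> size z <= B.
Proof.
case=> k fv; exists ((size w).+2 * k * output_bound) => z /fv[cs [r kv]].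
apply: leq_trans (run_output_bound r) _; rewrite leq_mul2r.
by rewrite (size_k_visiting kv) ?orbT //; apply: run_positions r.
Qed.

End Runs.

(** * Output paths of deterministic graphs *)

Lemma graph_iso_sym (Sg Gm : Type) (g h : graph Sg Gm) :
  graph_iso g h -> graph_iso h g.
Proof.
case=> f [[f' fK f'K] [labf edgef]]; exists f'; split; first by exists f.
by split=> [v|u e v]; rewrite -?labf -?edgef !f'K.
Qed.

Lemma graph_iso_trans (Sg Gm : Type) (g h k : graph Sg Gm) :
  graph_iso g h -> graph_iso h k -> graph_iso g k.
Proof.
case=> f [bf [labf edgef]] [f' [bf' [labf' edgef']]]; exists (f' \o f).
split; first exact: bij_comp.
by split=> [v|u e v] /=; rewrite ?labf' ?edgef'.
Qed.

Lemma ed_edgeE (A : eqType) (w : seq A) (i j : 'I_(size w).+1) a :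
  gE (ed w) i a j = (onth w i == Some a) && (j == i.+1 :> nat).
Proof.
apply/existsP/andP => [[k /and3P[/eqP eik /eqP ejk /eqP <-]]|[/eqP wi /eqP ji]].
  rewrite /= in eik ejk; rewrite eik ejk (tnth_nth a) /= (onthE w).
  by rewrite (nth_map a) ?eqxx.
have lt_i : i < size w by rewrite ltnNge; apply/negP => /onth_default; rewrite wi.
exists (Ordinal lt_i); rewrite /= ji !eqxx /= (tnth_nth a) /=.
by move: wi; rewrite onthE (nth_map a) // => -[->].
Qed.

(** The isomorphism sends a node to the index of its [phi]-image in [s]; injectivity and a
    cardinality count make it bijective. Going through [phi] lets [h] be a subset cut out of a
    larger vertex set. *)
Lemma graph_iso_ed (A : eqType) (h : graph unit A) (w : seq A) (X : eqType)
    (phi : gV h -> X) (s : seq X) :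
  injective phi -> (forall x, x \in s -> exists v, phi v = x) ->
  (forall v, phi v \in s) -> uniq s -> size s = (size w).+1 ->
  (forall u a v, gE h u a v =
     (onth w (index (phi u) s) == Some a) && (index (phi v) s == (index (phi u) s).+1)) ->
  graph_iso h (ed w).
Proof.
move=> phi_inj phi_surj phi_s us ss edgeh.
have lt_s v : index (phi v) s < (size w).+1 by rewrite -ss index_mem.
exists (fun v => Ordinal (lt_s v)); split; last first.
  by split=> [v|u a v]; [case: (glab h v)|rewrite ed_edgeE edgeh].
apply: inj_card_bij => [u v [eq_uv] |].
  by apply: phi_inj; rewrite -(nth_index (phi u) (phi_s u)) eq_uv nth_index.
rewrite card_ord -ss cardE -(size_map phi); apply: uniq_leq_size us _.
by move=> x /phi_surj[v <-]; rewrite map_f ?mem_enum.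
Qed.

Section Trace.
Variables (X : finType) (A : eqType) (e : rel X) (em : X -> option A) (fin : pred X).
Hypothesis e_det : forall x y y', e x y -> e x y' -> y = y'.
Hypothesis fin_stop : forall x y, fin x -> ~~ e x y.
Hypothesis fin_em : forall x, fin x -> em x = None.

Definition out_vertex x := fin x || em x.
(** Only the source has to be silent, so a chain of silent steps may end in an emitting vertex but
    cannot continue beyond it. *)
Definition silent_step : rel X := fun x y => e x y && ~~ em x.
Definition out_edge x a y :=
  (em x == Some a) && [exists d, e x d && connect silent_step d y].

Let s x p := filter out_vertex (x :: p).

(** By determinism any path from [x] follows [p], and it cannot go past the end of [p], where no
    step starts. *)
Lemma det_path_mem x p y : path e x p -> fin (last x p) ->
  connect e x y = (y \in x :: p).
Proof.
move=> xp fp; apply/idP/idP => [|]; last first.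
  move=> yp; case/splitPl: {p} yp xp {fp} => p1 p2 <-.
  by rewrite cat_path => /andP[xp1 _]; apply/connectP; exists p1.
case/connectP=> q xq ->{y}; elim: q x p xp fp xq => [|d q IH] x [|d' p] /=; rewrite ?mem_head //.
  by move=> _ /fin_stop/negPf->.
by move=> /andP[e1 dp] fp /andP[/(e_det e1) <- dq]; rewrite in_cons (IH d' p) ?orbT.
Qed.

Lemma det_path_inj x p q : path e x p -> path e x q ->
  fin (last x p) -> fin (last x q) -> p = q.
Proof.
elim: p x q => [|d p IH] x [|d' q] //=.
- by move=> _ /andP[xd' _] fx; rewrite (negPf (fin_stop _ fx)) in xd'.
- by move=> /andP[xd _] _ _ fx; rewrite (negPf (fin_stop _ fx)) in xd.
move=> /andP[/e_det ed dp] /andP[/ed eq_d]; rewrite -eq_d => dq fp fq.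
by rewrite (IH d q).
Qed.

(** If [x] recurred, the part after the recurrence and the whole path would both lead from [x] to a
    final vertex, and they differ in length. *)
Lemma det_path_uniq x p : path e x p -> fin (last x p) -> uniq (x :: p).
Proof.
elim: p x => //= d p IH x /andP[xd dp] fp; rewrite IH // andbT.
apply/negP=> xdp.
have [p1 [p2 [def_p lastp1]]] : exists p1 p2, p = p1 ++ p2 /\ last d p1 = x.
  by case/splitPl: xdp => p1 p2; exists p1, p2.
have xp2 : path e x p2 by move: dp; rewrite def_p cat_path lastp1 => /andP[].
have fp2 : fin (last x p2) by rewrite -lastp1 -last_cat -def_p.
have xdp' : path e x (d :: p) by rewrite /= xd.
have /(congr1 size) /= eq_size := det_path_inj xp2 xdp' fp2 fp.
have: size p2 <= size p by rewrite def_p size_cat leq_addl.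
by rewrite eq_size ltnn.
Qed.

(** A silent chain stops at the first output vertex it meets, and determinism keeps it on the path;
    hence that vertex is the only output vertex it can reach. *)
Lemma silent_reach x p y : path e x p -> fin (last x p) -> out_vertex y ->
  connect silent_step x y = (y == head x (s x p)).
Proof.
move=> xp fp oy; elim: p x xp fp => [|d p IH] x /=.
  move=> _ fx; rewrite /s /= /out_vertex fx /=.
  apply/idP/eqP => [/connectP[[|d q] /=]|->]; [by []| |exact: connect0].
  by rewrite /silent_step (negPf (fin_stop _ fx)).
move=> /andP[xd dp] fp; rewrite /s /=.
have nfx : fin x = false by apply/negP => /fin_stop/negP; apply; exact: xd.
case: ifP => ox /=.
  apply/idP/eqP => [/connectP[[|d' q] /=]|->]; [by []| |exact: connect0].
  by move: ox; rewrite /out_vertex /silent_step nfx /= => ->; rewrite andbF.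
have emx : ~~ em x by move: ox; rewrite /out_vertex nfx /= => ->.
(* The final vertex survives the filter, so the list is nonempty and the default of [head] does not
   matter. *)
have nsx : head x (filter out_vertex (d :: p)) = head d (s d p).
  rewrite /s; case E: (filter _ _) => [|//].
  have: last d p \in filter out_vertex (d :: p).
    by rewrite mem_filter /out_vertex fp mem_last.
  by rewrite E.
rewrite -/(filter out_vertex (d :: p)) nsx -IH //; apply/idP/idP => [/connectP[[|d' q] /=]|].
- by move=> _ eq_y; rewrite eq_y ox in oy.
- by rewrite {1}/silent_step => /andP[/andP[/(e_det xd) <- _] dq] ->; apply/connectP; exists q.
by apply: connect_trans; apply: connect1; rewrite /silent_step xd.
Qed.

(** Induction along the path: a silent first vertex changes nothing, while an emitting one adds a
    letter and shifts all indices by one. The final vertex is the one output vertex without a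
    letter, whence the successor in the size. *)
Lemma trace_edges x p (t := s x p) (z := pmap em (x :: p)) :
  path e x p -> fin (last x p) ->
  size t = (size z).+1 /\
  (forall u a v, u \in t -> v \in t ->
     out_edge u a v = (onth z (index u t) == Some a) && (index v t == (index u t).+1)).
Proof.
rewrite {}/t {}/z; elim: p x => [|d p IH] x.
  move=> _ fx; rewrite /s /= /out_vertex fx /= (fin_em fx); split=> // u a v.
  by rewrite inE => /eqP-> _; rewrite /out_edge (fin_em fx) onth0n.
move=> xp fp; have /andP[xd dp] : e x d && path e d p := xp.
have /andP[xdp _] : (x \notin d :: p) && uniq (d :: p) := det_path_uniq xp fp.
have nfx : fin x = false by apply/negP => /fin_stop/negP; apply; exact: xd.
have [ss edges] := IH d dp fp.
have -> : s x (d :: p) = if em x then x :: s d p else s d p.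
  by rewrite {1}/s /= {1}/out_vertex nfx.
have -> : pmap em [:: x, d & p] = oapp (cons^~ (pmap em (d :: p))) (pmap em (d :: p)) (em x).
  by rewrite /=; case: (em x).
case emx: (em x) => [a0|] /=; last by split.
split; first by rewrite ss.
have out_t v : v \in s d p -> out_vertex v by rewrite mem_filter => /andP[].
have x_t v : v \in s d p -> (x == v) = false.
  by rewrite mem_filter => /andP[_ v_dp]; apply: contraNF xdp => /eqP->.
move=> u a v; rewrite !inE => /orP[/eqP->{u}|u_t].
  rewrite eqxx /out_edge emx /=.
  have -> : [exists d0, e x d0 && connect silent_step d0 v] = connect silent_step d v.
    apply/existsP/idP => [[d' /andP[/(e_det xd) <-]] //|dv].
    by exists d; rewrite xd.
  (* An edge back to [x] would put [x] on the rest of the path, which is repetition-free; any other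
     target must be the first output vertex after [x]. *)
  case/orP=> [/eqP->|v_t].
    rewrite eqxx andbF; apply/negbTE; apply: contra xdp => /andP[_].
    rewrite -(det_path_mem x dp fp); apply: connect_sub => y y' /andP[yy' _].
    exact: connect1.
  rewrite x_t // eqSS (silent_reach dp fp) ?out_t //; congr andb.
  case: (s d p) v_t => //= y t _; rewrite eq_sym.
  by case: (y == v).
rewrite x_t //; case/orP=> [/eqP->|v_t].
  rewrite eqxx andbF; apply/negbTE; apply: contra xdp => /andP[_ /existsP[d' /andP[ud' dx]]].
  rewrite -(det_path_mem x dp fp).
  have du: connect e d u.
    by rewrite (det_path_mem u dp fp); move: u_t; rewrite mem_filter => /andP[].
  apply: connect_trans du (connect_trans (connect1 ud') _).
  by apply: connect_sub dx => y y' /andP[yy' _]; apply: connect1.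
by rewrite x_t // eqSS; apply: edges.
Qed.

Lemma trace_graph_iso (h : graph unit A) (phi : gV h -> X) x p :
  path e x p -> fin (last x p) -> injective phi ->
  (forall y, (exists v, phi v = y) <-> connect e x y && out_vertex y) ->
  (forall u a v, gE h u a v = out_edge (phi u) a (phi v)) ->
  graph_iso h (ed (pmap em (x :: p))).
Proof.
move=> xp fp phi_inj phi_img edgeh.
have [ss edges] := trace_edges xp fp.
have phi_s y : (exists v, phi v = y) <-> y \in s x p.
  by rewrite phi_img mem_filter andbC (det_path_mem y xp fp).
have phi_in v : phi v \in s x p by apply/phi_s; exists v.
apply: (graph_iso_ed phi_inj (s := s x p)) => //.
- by move=> y /phi_s.
- by rewrite filter_uniq // det_path_uniq.
by move=> u a v; rewrite edgeh edges.
Qed.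

End Trace.

(** * Semantics of monadic second-order formulas *)

Section Connectives.
Variables (Sg Gm : eqType).
Notation formula := (mso Sg Gm).

(** An equality of an unassigned variable with itself evaluates to false, so truth is expressed by a
    propositional tautology. *)
Definition MTrue : formula := MNot (MAnd (MEq _ _ 0 0) (MNot (MEq _ _ 0 0))).
Definition MBool (b : bool) : formula := if b then MTrue else MNot MTrue.
Definition MOr (f1 f2 : formula) : formula := MNot (MAnd (MNot f1) (MNot f2)).
Definition MBigOr (I : finType) (F : I -> formula) : formula :=
  foldr (fun i => MOr (F i)) (MBool false) (enum I).
Definition MBigAnd (I : finType) (F : I -> formula) : formula :=
  MNot (MBigOr (fun i => MNot (F i))).
Definition MAllN (x : nat) (f : formula) : formula := MNot (MExN x (MNot f)).
Definition MExSs (l : seq nat) (f : formula) : formula := foldr (@MExS Sg Gm) f l.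

Variable g : graph Sg Gm.
Implicit Types (nu : nat -> option (gV g)) (rho : nat -> {set gV g}).

Definition upd nu x v : nat -> option (gV g) := fun n => if n == x then Some v else nu n.

Lemma upd_same nu x v : upd nu x v x = Some v.
Proof. by rewrite /upd eqxx. Qed.

Lemma upd_lt nu x y v : y < x -> upd nu x v y = nu y.
Proof. by rewrite /upd; case: ltngtP. Qed.

Lemma sat_MAnd nu rho f1 f2 : sat nu rho (MAnd f1 f2) = sat nu rho f1 && sat nu rho f2.
Proof. by []. Qed.

Lemma sat_MNot nu rho f : sat nu rho (MNot f) = ~~ sat nu rho f.
Proof. by []. Qed.

Lemma sat_MBool nu rho b : sat nu rho (MBool b) = b.
Proof. by case: b => /=; rewrite andbN. Qed.

Lemma sat_MOr nu rho f1 f2 : sat nu rho (MOr f1 f2) = sat nu rho f1 || sat nu rho f2.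
Proof. by rewrite /= negb_and !negbK. Qed.

Lemma sat_MBigOr nu rho (I : finType) (F : I -> formula) :
  sat nu rho (MBigOr F) = [exists i, sat nu rho (F i)].
Proof.
transitivity (has (fun i => sat nu rho (F i)) (enum I)).
  by rewrite /MBigOr; elim: (enum I) => [|i s IH]; rewrite ?sat_MBool ?sat_MOr //= IH.
by apply/hasP/existsP => [[i _ Fi]|[i Fi]]; exists i; rewrite ?mem_enum.
Qed.

Lemma sat_MBigAnd nu rho (I : finType) (F : I -> formula) :
  sat nu rho (MBigAnd F) = [forall i, sat nu rho (F i)].
Proof. by rewrite sat_MNot sat_MBigOr negb_exists; apply: eq_forallb => i /=; rewrite negbK. Qed.

Lemma sat_MExN nu rho x f : sat nu rho (MExN x f) = [exists v, sat (upd nu x v) rho f].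
Proof. by []. Qed.

Lemma sat_MAllN nu rho x f : sat nu rho (MAllN x f) = [forall v, sat (upd nu x v) rho f].
Proof. by rewrite /= negb_exists; apply: eq_forallb => i; rewrite negbK. Qed.

Lemma sat_MEdge nu rho a x y u v : nu x = Some u -> nu y = Some v ->
  sat nu rho (MEdge Sg a x y) = gE g u a v.
Proof. by move=> /= -> ->. Qed.

Lemma sat_MEq nu rho x y u v : nu x = Some u -> nu y = Some v ->
  sat nu rho (MEq Sg Gm x y) = (u == v).
Proof. by move=> /= -> ->. Qed.

Lemma sat_MIn nu rho x X u : nu x = Some u -> sat nu rho (MIn Sg Gm x X) = (u \in rho X).
Proof. by move=> /= ->. Qed.

Lemma sat_ext nu rho rho' f : rho =1 rho' -> sat nu rho f = sat nu rho' f.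
Proof.
elim: f nu rho rho' => //=.
- by move=> x X nu rho rho' eq_rho; case: (nu x) => // v; rewrite eq_rho.
- by move=> f IH nu rho rho' /IH->.
- by move=> f1 IH1 f2 IH2 nu rho rho' eq_rho; rewrite (IH1 _ _ _ eq_rho) (IH2 _ _ _ eq_rho).
- by move=> x f IH nu rho rho' /IH eq_rho; apply: eq_existsb => v.
move=> X f IH nu rho rho' eq_rho; apply: eq_existsb => S.
by apply: IH => n; case: eqP.
Qed.

Lemma sat_MExSs l nu rho f : sat nu rho (MExSs l f) <->
  exists rho', (forall n, n \notin l -> rho' n = rho n) /\ sat nu rho' f.
Proof.
elim: l rho => [|X l IH] rho /=.
  split=> [fr|[rho' [eq_rho]]]; first by exists rho.
  by rewrite (@sat_ext _ rho' rho) // => n; apply: eq_rho.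
split=> [/existsP[S /IH[rho' [eq_rho fr]]]|[rho' [eq_rho fr]]].
  exists rho'; split=> // n; rewrite inE negb_or => /andP[nX /eq_rho->].
  by rewrite (negPf nX).
apply/existsP; exists (rho' X); apply/IH; exists rho'; split=> // n nl.
by case: eqP => [->//|/eqP nX]; apply: eq_rho; rewrite inE (negPf nX).
Qed.

(** * Reachability through closed families of sets *)

Section Reach.
Variables (N : nat) (K : finType) (step : K -> K -> nat -> nat -> formula).

Let Z (k : K) : nat := N + enum_rank k.

(* The second component of a vertex [(u, k)] is a copy: [step k1 k2 x y] defines the
   edges from copy [k1] of [x] to copy [k2] of [y]. Bound node variables 0 and 1 may
   capture [x] and [y] harmlessly, and set variables from [N] on are taken as fresh. *)
Definition MReach (k k' : K) (x y : nat) : formula :=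
  MNot (MExSs (iota N #|K|) (MAnd (MAnd (MIn _ _ x (Z k)) (MNot (MIn _ _ y (Z k'))))
    (MBigAnd (fun k1 => MBigAnd (fun k2 => MAllN 0 (MAllN 1
       (MNot (MAnd (MAnd (MIn _ _ 0 (Z k1)) (step k1 k2 0 1))
                   (MNot (MIn _ _ 1 (Z k2))))))))))).

Variables (rho : nat -> {set gV g}) (e : rel (gV g * K)).
(** Quantifying over every [nu] and every [rho'] that agrees with [rho] below [N] makes the value of
    [step] independent of the variables bound by [MReach]. *)
Hypothesis stepE : forall rho' nu x y u v k1 k2, (forall n, n < N -> rho' n = rho n) ->
  nu x = Some u -> nu y = Some v -> sat nu rho' (step k1 k2 x y) = e (u, k1) (v, k2).

Lemma sat_MReach nu x y u v k k' : nu x = Some u -> nu y = Some v ->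
  sat nu rho (MReach k k' x y) = connect e (u, k) (v, k').
Proof.
move=> xu yv; rewrite sat_MNot.
have Z_iota k1 : Z k1 \in iota N #|K| by rewrite mem_iota leq_addr ltn_add2l ltn_ord.
have closedE rho' : (forall n, n < N -> rho' n = rho n) ->
  sat nu rho' (MBigAnd (fun k1 => MBigAnd (fun k2 => MAllN 0 (MAllN 1
       (MNot (MAnd (MAnd (MIn _ _ 0 (Z k1)) (step k1 k2 0 1))
                   (MNot (MIn _ _ 1 (Z k2))))))))) ->
  forall p q, e p q -> p.1 \in rho' (Z p.2) -> q.1 \in rho' (Z q.2).
  move=> agree; rewrite sat_MBigAnd => /forallP cl [s k1] [t k2] /= est s_in.
  move/(_ k1): cl; rewrite sat_MBigAnd => /forallP/(_ k2).
  rewrite sat_MAllN => /forallP/(_ s); rewrite sat_MAllN => /forallP/(_ t).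
  rewrite sat_MNot !sat_MAnd sat_MNot (stepE (u := s) (v := t)) ?est //.
  by rewrite (sat_MIn _ _ (u := s)) // (sat_MIn _ _ (u := t)) // s_in /= negbK.
apply/negP/connectP => [nsat|[p pp lastp]].
  (* If the target is unreachable, the vertices reachable from [(u, k)], sorted by copy, form a
     closed family that separates it from the source. *)
  apply/connectP/negPn/negP => nconn; apply/nsat/sat_MExSs.
  exists (fun n => if [pick k1 | Z k1 == n] is Some k1
            then [set s | connect e (u, k) (s, k1)] else rho n).
  have ZE k1 : [pick k2 | Z k2 == Z k1] = Some k1.
    by case: pickP => [k2 /eqP/addnI/val_inj/enum_rank_inj->//|/(_ k1)]; rewrite eqxx.
  set rho' := (X in sat _ X).
  have agree n : n \notin iota N #|K| -> rho' n = rho n.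
    rewrite /rho' => nN; case: pickP => // k1 /eqP Zn.
    by rewrite -Zn Z_iota in nN.
  split=> //.
  rewrite !sat_MAnd sat_MNot (sat_MIn _ _ xu) (sat_MIn _ _ yv) /rho' !ZE !inE connect0 nconn !andTb.
    rewrite sat_MBigAnd; apply/forallP => k1; rewrite sat_MBigAnd; apply/forallP => k2.
  rewrite sat_MAllN; apply/forallP => s; rewrite sat_MAllN; apply/forallP => t.
  rewrite sat_MNot !sat_MAnd sat_MNot (sat_MIn _ _ (u := s)) // (sat_MIn _ _ (u := t)) //.
  rewrite (stepE (u := s) (v := t)) //; last first.
    by move=> n ltn; apply: agree; rewrite mem_iota leqNgt ltn.
  rewrite !ZE !inE; apply/negP => /andP[/andP[us st] /negP]; apply.
  exact: connect_trans us (connect1 st).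
(* Conversely, a closed family that contains the start of a path contains its end. *)
case/sat_MExSs=> rho' [agree]; rewrite !sat_MAnd sat_MNot (sat_MIn _ _ xu) (sat_MIn _ _ yv).
case/andP=> /andP[u_in /negP v_notin] /closedE cl; apply: v_notin.
have {}cl : forall p q, e p q -> p.1 \in rho' (Z p.2) -> q.1 \in rho' (Z q.2).
  by apply: cl => n ltn; apply: agree; rewrite mem_iota leqNgt ltn.
suff: forall p c, c.1 \in rho' (Z c.2) -> path e c p ->
   (last c p).1 \in rho' (Z (last c p).2) by move=> /(_ p (u, k) u_in pp); rewrite -lastp.
elim=> //= d q IH c c_in /andP[cd dq]; apply: IH => //.
exact: cl cd c_in.
Qed.

End Reach.
End Connectives.

(** * Computations under a memoryless strategy *)

Section Strategy.
Variables (S1 S2 : finType) (M : gsm S1 S2).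

Definition index_ins := 'I_(size (gdelta M)).
Definition ins (t : index_ins) := tnth (in_tuple (gdelta M)) t.
(** Throughout, [r] is the outcome of the instruction's test on the scanned symbol. *)
Definition target t (r : bool) := if r then i_q1 (ins t) else i_q0 (ins t).
Definition word t (r : bool) := if r then i_a1 (ins t) else i_a0 (ins t).
Definition heading t (r : bool) := if r then i_d1 (ins t) else i_d0 (ins t).

Lemma In_ins i : List.In i (gdelta M) <-> exists t, ins t = i.
Proof.
rewrite /ins /index_ins; elim: (gdelta M) => /= [|j s IH].
  by split=> // -[[]].
split=> [[->|/IH[t <-]]|[t]].
- by exists ord0; rewrite (tnth_nth i).
- by exists (lift ord0 t); rewrite !(tnth_nth j).
case: (unliftP ord0 t) => [t' ->|->]; rewrite (tnth_nth j) => def_i; last by left.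
by right; apply/IH; exists t'; rewrite (tnth_nth j).
Qed.

Lemma size_word t r : size (word t r) <= output_bound M.
Proof.
have /instr_output_bound[] : List.In (ins t) (gdelta M) by apply/In_ins; exists t.
by case: r.
Qed.

Lemma ins_not_final t : i_p (ins t) != gqf M.
Proof.
have /all_tnthP/(_ t) : all (fun i => i_p i != gqf M) (in_tuple (gdelta M)) by exact: gwf.
by [].
Qed.

(* Tape position [k <= |w|] is the node [k] of [ed w], and position [|w|+1] is a second
   copy, flagged by [true], of the last node; the symbol at a position is thus the label of
   the incoming edge. The third component of a copy counts the letters of the current
   instruction's output word that have already been written. *)
Definition copy : finType := (gQ M * bool * 'I_(output_bound M).+1)%type.

Definition copy0 (q : gQ M) (b : bool) : copy := (q, b, ord0).

(** The set variable that holds the parameter [Y t b]; variables from [n_codes] on stay fresh for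
    [MReach]. *)
Definition code (t : index_ins) (b : bool) : nat := enum_rank (t, b).
Definition n_codes := #|{: index_ins * bool}|.

Lemma code_lt t b : code t b < n_codes.
Proof. exact: ltn_ord. Qed.

Section Semantics.
Variables (g : graph unit S1) (Y : index_ins -> bool -> {set gV g}).

Definition tape_read (v : gV g) (b : bool) (s : tape_sym S1) : bool :=
  match s with
  | LEnd => ~~ b && ~~ [exists a, [exists u, gE g u a v]]
  | REnd => b
  | Sym a => ~~ b && [exists u, gE g u a v]
  end.

Definition last_node (v : gV g) : bool := ~~ [exists a, [exists u, gE g v a u]].

(** Moves between positions [|w|] and [|w|+1] keep the node and change the flag; all other left or
    right moves cross an edge. *)
Definition head_move (d : dir) (v : gV g) (b : bool) (v' : gV g) (b' : bool) : bool :=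
  match d with
  | Left => ~~ b' && (if b then v' == v else [exists a, gE g v' a v])
  | Stay => (b' == b) && (v' == v)
  | Right => ~~ b && (if b' then (v' == v) && last_node v else [exists a, gE g v a v'])
  end.

(* [Y t b] is the set of nodes at which the strategy proposes instruction [t]. *)
Definition chosen t (q : gQ M) (v : gV g) (b : bool) : bool :=
  [forall t', ((i_p (ins t') == q) && (v \in Y t' b)) == (t' == t)].

(** Arbitrary parameters may propose no instruction or several for one state. Since [chosen] asks
    for exactly one, such a vertex gets no successor and the graph remains deterministic. *)
Definition enabled t r (q : gQ M) (v : gV g) (b : bool) : bool :=
  chosen t q v b && (tape_read v b (i_sym (ins t)) == r).

(** An instruction writing n letters is spread over n steps that only advance the counter, followed
    by a silent step that changes the configuration. Thus a vertex emits at most one letter. *)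
Definition vertex_step : rel (gV g * copy) := fun x y =>
  [exists t, [exists r, enabled t r x.2.1.1 x.1 x.2.1.2 &&
    (if x.2.2 < size (word t r) then
       ((y.2.1 == x.2.1) && (y.2.2 == x.2.2.+1 :> nat)) && (y.1 == x.1)
     else ((y.2.1.1 == target t r) && (y.2.2 == 0 :> nat)) &&
          head_move (heading t r) x.1 x.2.1.2 y.1 y.2.1.2)]].

Definition vertex_emits (x : gV g * copy) (a : S2) : bool :=
  [exists t, [exists r, enabled t r x.2.1.1 x.1 x.2.1.2 &&
     (onth (word t r) x.2.2 == Some a)]].

Definition vertex_out (x : gV g * copy) : option S2 := [pick a | vertex_emits x a].

Definition vertex_final (x : gV g * copy) : bool := x.2.1.1 == gqf M.

End Semantics.

(** * Formulas for the configuration graph of a strategy *)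

Notation formula := (mso unit S1).

(** The bound variable [x.+1] is chosen to differ from [x], the only free node variable. *)
Definition fRead (s : tape_sym S1) (b : bool) (x : nat) : formula :=
  match s with
  | LEnd => MAnd (MBool _ _ (~~ b))
              (MNot (MBigOr (fun a : S1 => MExN x.+1 (MEdge _ a x.+1 x))))
  | REnd => MBool _ _ b
  | Sym a => MAnd (MBool _ _ (~~ b)) (MExN x.+1 (MEdge _ a x.+1 x))
  end.

Definition fLast (x : nat) : formula :=
  MNot (MBigOr (fun a : S1 => MExN x.+1 (MEdge _ a x x.+1))).

Definition fMove (d : dir) (b b' : bool) (x y : nat) : formula :=
  match d with
  | Left => MAnd (MBool _ _ (~~ b'))
      (if b then MEq _ _ y x else MBigOr (fun a : S1 => MEdge _ a y x))
  | Stay => MAnd (MBool _ _ (b' == b)) (MEq _ _ y x)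
  | Right => MAnd (MBool _ _ (~~ b))
      (if b' then MAnd (MEq _ _ y x) (fLast x) else MBigOr (fun a : S1 => MEdge _ a x y))
  end.

Definition fProposed (t : index_ins) (q : gQ M) (b : bool) (x : nat) : formula :=
  MAnd (MBool _ _ (i_p (ins t) == q)) (MIn _ _ x (code t b)).

Definition fEnabled t r (q : gQ M) (b : bool) (x : nat) : formula :=
  MAnd (MBigAnd (fun t' : index_ins =>
     if t' == t then fProposed t' q b x else MNot (fProposed t' q b x)))
    (if r then fRead (i_sym (ins t)) b x else MNot (fRead (i_sym (ins t)) b x)).

Definition fStep (k k' : copy) (x y : nat) : formula :=
  MBigOr (fun t : index_ins => MBigOr (fun r : bool =>
    MAnd (fEnabled t r k.1.1 k.1.2 x)
      (if k.2 < size (word t r) then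
         MAnd (MBool _ _ ((k'.1 == k.1) && (k'.2 == k.2.+1 :> nat))) (MEq _ _ y x)
       else MAnd (MBool _ _ ((k'.1.1 == target t r) && (k'.2 == 0 :> nat)))
          (fMove (heading t r) k.1.2 k'.1.2 x y)))).

Definition fEmits (k : copy) (a : S2) (x : nat) : formula :=
  MBigOr (fun t : index_ins => MBigOr (fun r : bool =>
    MAnd (fEnabled t r k.1.1 k.1.2 x) (MBool _ _ (onth (word t r) k.2 == Some a)))).

Definition fSilent (k k' : copy) (x y : nat) : formula :=
  MAnd (fStep k k' x y) (MNot (MBigOr (fun a => fEmits k a x))).

Section Sat.
Variables (g : graph unit S1) (Y : index_ins -> bool -> {set gV g}).
Implicit Types (nu : nat -> option (gV g)) (rho : nat -> {set gV g}) (u v : gV g).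

Lemma sat_fRead nu rho s b x u : nu x = Some u -> sat nu rho (fRead s b x) = tape_read u b s.
Proof.
move=> xu; have readE a :
    sat nu rho (MExN x.+1 (MEdge _ a x.+1 x)) = [exists v, gE g v a u].
  rewrite sat_MExN; apply: eq_existsb => v.
  by rewrite (sat_MEdge _ _ (upd_same _ _ _) (v := u)) // upd_lt.
case: s => [||a] /=; rewrite ?sat_MAnd ?sat_MBool //; last by rewrite -readE.
by rewrite sat_MBigOr; congr (_ && ~~ _); apply: eq_existsb => a; rewrite -readE.
Qed.

Lemma sat_fLast nu rho x u : nu x = Some u -> sat nu rho (fLast x) = last_node u.
Proof.
move=> xu; rewrite sat_MNot sat_MBigOr; congr negb; apply: eq_existsb => a.
rewrite sat_MExN; apply: eq_existsb => v.
by rewrite (sat_MEdge _ _ (v := v) (u := u)) ?upd_same // upd_lt.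
Qed.

Lemma sat_fMove nu rho d b b' x y u v : nu x = Some u -> nu y = Some v ->
  sat nu rho (fMove d b b' x y) = head_move d u b v b'.
Proof.
move=> xu yv; case: d; rewrite sat_MAnd sat_MBool; congr andb.
- case: b; first by rewrite (sat_MEq _ yv xu).
  by rewrite sat_MBigOr; apply: eq_existsb => a; rewrite (sat_MEdge _ _ yv xu).
- by rewrite (sat_MEq _ yv xu).
case: b'; first by rewrite sat_MAnd (sat_MEq _ yv xu) (sat_fLast _ xu).
by rewrite sat_MBigOr; apply: eq_existsb => a; rewrite (sat_MEdge _ _ xu yv).
Qed.

Lemma sat_fEnabled nu rho t r q b x u : (forall t b, rho (code t b) = Y t b) ->
  nu x = Some u -> sat nu rho (fEnabled t r q b x) = enabled Y t r q u b.
Proof.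
move=> rhoY xu; rewrite sat_MAnd sat_MBigAnd; congr andb.
  apply: eq_forallb => t'; rewrite [in RHS]eq_sym.
  have fE : sat nu rho (fProposed t' q b x) = (i_p (ins t') == q) && (u \in Y t' b).
    by rewrite sat_MAnd sat_MBool (sat_MIn _ _ xu) rhoY.
  by rewrite (fun_if (sat nu rho)) sat_MNot fE; case: eqP; case: (_ && _).
by case: r; rewrite ?sat_MNot (sat_fRead _ _ _ xu) ?eqb_id // eqbF_neg.
Qed.

Lemma sat_fStep nu rho k k' x y u v : (forall t b, rho (code t b) = Y t b) ->
  nu x = Some u -> nu y = Some v ->
  sat nu rho (fStep k k' x y) = vertex_step Y (u, k) (v, k').
Proof.
move=> rhoY xu yv; rewrite sat_MBigOr; apply: eq_existsb => t.
rewrite sat_MBigOr; apply: eq_existsb => r.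
rewrite sat_MAnd (sat_fEnabled _ _ _ _ rhoY xu); congr andb => /=.
by case: ifP; rewrite sat_MAnd sat_MBool ?(sat_MEq _ yv xu) ?(sat_fMove _ _ _ _ xu yv).
Qed.

Lemma sat_fEmits nu rho k a x u : (forall t b, rho (code t b) = Y t b) ->
  nu x = Some u -> sat nu rho (fEmits k a x) = vertex_emits Y (u, k) a.
Proof.
move=> rhoY xu; rewrite sat_MBigOr; apply: eq_existsb => t.
rewrite sat_MBigOr; apply: eq_existsb => r.
by rewrite sat_MAnd (sat_fEnabled _ _ _ _ rhoY xu) sat_MBool.
Qed.

Lemma vertex_outE x : isSome (vertex_out Y x) = [exists a, vertex_emits Y x a].
Proof.
rewrite /vertex_out; case: pickP => [a xa|none]; first by symmetry; apply/existsP; exists a.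
by symmetry; apply/negbTE/existsPn => a; rewrite none.
Qed.

Lemma sat_fSilent nu rho k k' x y u v : (forall t b, rho (code t b) = Y t b) ->
  nu x = Some u -> nu y = Some v -> sat nu rho (fSilent k k' x y) =
    silent_step (vertex_step Y) (vertex_out Y) (u, k) (v, k').
Proof.
move=> rhoY xu yv; rewrite sat_MAnd (sat_fStep _ _ rhoY xu yv) sat_MNot sat_MBigOr.
rewrite /silent_step vertex_outE; congr (_ && ~~ _); apply: eq_existsb => a.
exact: sat_fEmits.
Qed.

Lemma sat_reach_step nu rho k k' x y u v : (forall t b, rho (code t b) = Y t b) ->
  nu x = Some u -> nu y = Some v ->
  sat nu rho (MReach n_codes fStep k k' x y) = connect (vertex_step Y) (u, k) (v, k').
Proof.
move=> rhoY; apply: sat_MReach => rho' nu' x' y' u' v' k1 k2 agree.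
by apply: sat_fStep => t b; rewrite agree ?code_lt.
Qed.

Lemma sat_reach_silent nu rho k k' x y u v : (forall t b, rho (code t b) = Y t b) ->
  nu x = Some u -> nu y = Some v ->
  sat nu rho (MReach n_codes fSilent k k' x y) =
    connect (silent_step (vertex_step Y) (vertex_out Y)) (u, k) (v, k').
Proof.
move=> rhoY; apply: sat_MReach => rho' nu' x' y' u' v' k1 k2 agree.
by apply: sat_fSilent => t b; rewrite agree ?code_lt.
Qed.

End Sat.

End Strategy.

(** * Correctness of the strategy encoding *)

Lemma scanS (S : Type) (w : seq S) i :
  scan w i.+1 = if onth w i is Some a then Sym a else REnd.
Proof.
rewrite /=; elim: w i => [|a w IH] [|i] //=.
Qed.

#[local] Arguments scan : simpl never.

Section Simulation.
Variables (S1 S2 : finType) (M : gsm S1 S2) (w : seq S1).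
Variables (g : graph unit S1) (f : gV g -> 'I_(size w).+1).
Hypotheses (f_bij : bijective f) (f_edge : forall u a v,
  gE g u a v = (onth w (f u) == Some a) && (f v == (f u).+1 :> nat)).

Definition position (v : gV g) (b : bool) : nat := if b then (size w).+1 else f v.
(** The flagged copy represents a tape position only over the last node. On valid pairs [position]
    is injective, and [head_move] preserves validity. *)
Definition valid (v : gV g) (b : bool) : bool := b ==> (f v == size w :> nat).

Lemma node_at i : i <= size w -> exists v, f v = i :> nat.
Proof.
rewrite -ltnS => lt_i; have [f' _ f'K] := f_bij.
by exists (f' (Ordinal lt_i)); rewrite f'K.
Qed.

Lemma node_inj u v : f u = f v :> nat -> u = v.
Proof. by move/val_inj/(bij_inj f_bij). Qed.

Lemma node_le v : f v <= size w.
Proof. by rewrite -ltnS ltn_ord. Qed.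

Lemma some_edgeE u v : [exists a, gE g u a v] = (f v == (f u).+1 :> nat).
Proof.
apply/existsP/eqP => [[a]|fv]; first by rewrite f_edge => /andP[_ /eqP].
have : isSome (onth w (f u)) by rewrite onthTE -fv node_le.
case wu: (onth w (f u)) => [a|//] _; exists a.
by rewrite f_edge wu fv !eqxx.
Qed.

Lemma last_nodeE v : last_node v = (f v == size w :> nat).
Proof.
apply/idP/eqP => [|fv].
  move=> nlast; apply/eqP; rewrite eqn_leq node_le leqNgt; apply: contra nlast => lt_v.
  have [u fu] := node_at lt_v.
  have /existsP[a vau] : [exists a, gE g v a u] by rewrite some_edgeE fu.
  by apply/existsP; exists a; apply/existsP; exists u.
apply/existsPn => a; apply/existsPn => u; rewrite f_edge onth_default ?fv //.
Qed.

Lemma tape_readP v b s : valid v b ->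
  tape_read v b s <-> scan w (position v b) = s.
Proof.
rewrite /valid /position; case: b => /= [_|_].
  by rewrite scanS onth_default //; case: s.
have [fv|[k fv]] : f v = 0 :> nat \/ exists k, f v = k.+1 :> nat.
  by case: (nat_of_ord (f v)) => [|k]; [left|right; exists k].
  have no_in a : [exists u, gE g u a v] = false.
    by apply/existsPn => u; rewrite f_edge fv andbF.
  rewrite fv; case: s => [||a] /=; rewrite ?no_in; try by split.
  have -> : [exists a, [exists u, gE g u a v]] = false by apply/existsPn => a; rewrite no_in.
  by split.
rewrite fv scanS.
have lt_k : k < size w by rewrite -fv node_le.
have [u fu] := node_at (ltnW lt_k).
have : isSome (onth w k) by rewrite onthTE.
case wk: (onth w k) => [c|//] _.
have inE a : [exists u, gE g u a v] = (a == c).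
  apply/existsP/eqP => [[u']|->]; last by exists u; rewrite f_edge fu wk fv !eqxx.
  by rewrite f_edge fv eqSS => /andP[/eqP wu /eqP ku]; move: wk; rewrite ku wu => -[].
case: s => [||a] /=; rewrite ?inE; try by split.
  have -> : [exists a, [exists u, gE g u a v]] by apply/existsP; exists c; rewrite inE.
  by split.
by split=> [/eqP->|[->]].
Qed.

Lemma valid_inj v b v' b' : valid v b -> valid v' b' ->
  position v b = position v' b' -> v = v' /\ b = b'.
Proof.
rewrite /valid /position; case: b; case: b' => /=.
- by move=> /eqP fv /eqP fv' _; split=> //; apply: node_inj; rewrite fv.
- by move=> _ _ fv; have:= node_le v'; rewrite -fv ltnn.
- by move=> _ _ fv; have:= node_le v; rewrite fv ltnn.
by move=> _ _ /node_inj->.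
Qed.

Lemma head_move_sound d v b v' b' : valid v b -> head_move d v b v' b' ->
  valid v' b' /\ move (size w) (position v b) d (position v' b').
Proof.
rewrite /valid /position /move; case: d => /=.
- case: b' => //=; case: b => /= [/eqP fv /eqP->|_].
    by rewrite fv; split=> //; split.
  by rewrite some_edgeE => /eqP fv; split=> //; split=> //; rewrite leqW ?node_le.
- move=> vb /andP[/eqP-> /eqP->]; split=> //; split=> //.
  by case: ifP => // _; rewrite leqW ?node_le.
case: b => //= _; case: b' => /=; last first.
  by rewrite some_edgeE => /eqP fv; split=> //; split=> //; rewrite leqW ?node_le.
by rewrite last_nodeE => /andP[/eqP-> /eqP->].
Qed.

Lemma position_at j : j <= (size w).+1 -> exists v b, valid v b /\ position v b = j.
Proof.
rewrite leq_eqVlt ltnS => /orP[/eqP->|/node_at[v fv]]; last by exists v, false.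
by have [v fv] := node_at (leqnn _); exists v, true; rewrite /valid fv /=.
Qed.

Lemma head_move_complete d v b v' b' : valid v b -> valid v' b' ->
  move (size w) (position v b) d (position v' b') -> head_move d v b v' b'.
Proof.
move=> vb vb' []; case: d => _ /=.
- move: vb vb'; rewrite /valid /position; case: b'; case: b => //=.
  + by move=> _ _ /eqP; rewrite eqSS; elim: (size w).
  + by move=> _ _ eqv; have:= node_le v; rewrite -eqv ltnNge leqnSn.
  + by move=> /eqP fv _ [fv']; apply/eqP/node_inj; rewrite fv.
  by move=> _ _ fv; rewrite some_edgeE fv.
- by case/(valid_inj vb' vb) => -> ->; rewrite !eqxx.
move: vb vb'; rewrite /valid /position; case: b'; case: b => //=.
- by move=> _ _ /eqP; rewrite eqSS; elim: (size w).
- by move=> _ /eqP fv' [fv]; rewrite last_nodeE -fv eqxx andbT; apply/eqP/node_inj; rewrite fv'.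
- by move=> _ _ fv; have:= node_le v'; rewrite fv ltnNge leqnSn.
by move=> _ _ fv; rewrite some_edgeE fv.
Qed.

(** A right move into the flagged copy requires the last node, from which no edge leaves, so the two
    kinds of right move exclude each other. *)
Lemma head_move_det d (v : gV g) b (v1 : gV g) b1 (v2 : gV g) b2 :
  head_move d v b v1 b1 -> head_move d v b v2 b2 ->
  v1 = v2 /\ b1 = b2.
Proof.
case: d => /=.
- case: b1 b2 => [] [] //=; case: b => [/eqP-> /eqP->//|].
  by rewrite !some_edgeE => /eqP-> /eqP[/node_inj->].
- by move=> /andP[/eqP-> /eqP->] /andP[/eqP-> /eqP->].
case: b => //=; rewrite !last_nodeE !some_edgeE; case: b1; case: b2.
- by move=> /andP[/eqP-> _] /andP[/eqP-> _].
- by move=> /andP[_ /eqP->] /eqP fv; have:= node_le v2; rewrite fv ltnn.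
- by move=> /eqP fv1 /andP[_ /eqP fv]; have:= node_le v1; rewrite fv1 fv ltnn.
by move=> /eqP fv1 /eqP fv2; split=> //; apply: node_inj; rewrite fv1.
Qed.

(** * From paths under a strategy to computations *)

Section WithStrategy.
Variable Y : index_ins M -> bool -> {set gV g}.
Notation estep := (vertex_step Y).
Notation eout := (vertex_out Y).

Lemma chosen_uniq t1 t2 (q : gQ M) (v : gV g) b :
  chosen Y t1 q v b -> chosen Y t2 q v b -> t1 = t2.
Proof.
move=> /forallP/(_ t1)/eqP e1 /forallP/(_ t1)/eqP.
by rewrite e1 eqxx => /esym/eqP.
Qed.

Lemma chosen_state t (q : gQ M) (v : gV g) b : chosen Y t q v b -> i_p (ins t) = q.
Proof. by move/forallP/(_ t)/eqP; rewrite eqxx => /andP[/eqP]. Qed.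

Lemma enabled_uniq t1 r1 t2 r2 (q : gQ M) (v : gV g) b :
  enabled Y t1 r1 q v b -> enabled Y t2 r2 q v b -> t1 = t2 /\ r1 = r2.
Proof.
move=> /andP[ch1 /eqP <-] /andP[ch2 /eqP <-].
by rewrite (chosen_uniq ch1 ch2).
Qed.

Lemma enabled_not_final t r (x : gV g * copy M) :
  enabled Y t r x.2.1.1 x.1 x.2.1.2 -> ~~ vertex_final x.
Proof. by rewrite /vertex_final => /andP[/chosen_state <- _]; apply: ins_not_final. Qed.

Lemma vertex_step_det x y y' : estep x y -> estep x y' -> y = y'.
Proof.
move=> /existsP[t /existsP[r /andP[en +]]] /existsP[t' /existsP[r' /andP[en' +]]].
have [<- <-] := enabled_uniq en en'.
case: x {en en'} y y' => [v [[q b] l]] [v1 [[q1 b1] l1]] [v2 [[q2 b2] l2]] /=.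
case: ifP => _ /andP[/andP[/eqP e1 /eqP e2] e3] /andP[/andP[/eqP e1' /eqP e2'] e3'].
  rewrite e1 e1' (eqP e3) (eqP e3'); congr (_, (_, _)).
  by apply: val_inj; rewrite /= e2 e2'.
have [-> ->] := head_move_det e3 e3'; rewrite e1 e1'; congr (_, (_, _)).
by apply: val_inj; rewrite /= e2 e2'.
Qed.

Lemma vertex_final_stop x y : vertex_final x -> ~~ estep x y.
Proof.
move=> fx; apply/existsPn => t; apply/existsPn => r; apply/negP => /andP[/enabled_not_final].
by rewrite fx.
Qed.

Lemma vertex_out_enabled t r x : enabled Y t r x.2.1.1 x.1 x.2.1.2 ->
  eout x = onth (word t r) x.2.2.
Proof.
move=> en; rewrite /vertex_out; case: pickP => [a /existsP[t' /existsP[r' /andP[en' /eqP]]]|none].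
  by have [<- <-] := enabled_uniq en en'.
case wl: (onth _ _) => [a|//]; have /existsP[] := negbT (none a).
by exists t; apply/existsP; exists r; rewrite en wl eqxx.
Qed.

Lemma vertex_final_out x : vertex_final x -> eout x = None.
Proof.
move=> fx; rewrite /vertex_out.
case: pickP => // a /existsP[t /existsP[r /andP[/enabled_not_final]]].
by rewrite fx.
Qed.

Lemma vertex_outP x a : (eout x == Some a) = vertex_emits Y x a.
Proof.
apply/eqP/existsP => [|[t /existsP[r /andP[/vertex_out_enabled-> /eqP]]]//].
by rewrite /vertex_out; case: pickP => // a' /existsP + [<-].
Qed.

Lemma enabled_step t r v b (c' : config M) : enabled Y t r (i_p (ins t)) v b -> valid v b ->
  c'.1 = target t r -> move (size w) (position v b) (heading t r) c'.2 ->
  step M w (i_p (ins t), position v b) c' (word t r).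
Proof.
move=> /andP[_ rd] vb tgt mv; exists (ins t); first by apply/In_ins; exists t.
split=> //; move: rd tgt mv; rewrite /target /word /heading; case: r => rd tgt mv; [left|right].
  by split=> //; apply/(tape_readP _ vb); rewrite (eqP rd).
by split=> //; move/eqP: rd => rd /(tape_readP _ vb); rewrite rd.
Qed.

(** The path may start in the middle of an output word, whereas the run starts at the beginning of
    that instruction; [take] supplies the letters written before the path begins. The last clause
    also covers final vertices, where no instruction is enabled. *)
Lemma path_run (x : gV g * copy M) p : valid x.1 x.2.1.2 -> path estep x p ->
  vertex_final (last x p) ->
  exists cs z, [/\ run M w (x.2.1.1, position x.1 x.2.1.2) cs z,
    forall t r, enabled Y t r x.2.1.1 x.1 x.2.1.2 ->
      z = take x.2.2 (word t r) ++ pmap eout (x :: p) &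
    x.2.2 = 0 :> nat -> z = pmap eout (x :: p)].
Proof.
elim: p x => [|y p IH] x vx /=.
  move=> _ fx; exists [:: (x.2.1.1, position x.1 x.2.1.2)], [::]; split.
  - exact/run_end/eqP.
  - by move=> t r /enabled_not_final; rewrite fx.
  by rewrite (vertex_final_out fx).
case/andP=> xy yp fp.
suff [cs [z [rz Hz]]]: exists cs z, run M w (x.2.1.1, position x.1 x.2.1.2) cs z /\
    forall t r, enabled Y t r x.2.1.1 x.1 x.2.1.2 ->
      z = take x.2.2 (word t r) ++ pmap eout (x :: y :: p).
  exists cs, z; split=> // x0; case/existsP: xy => t /existsP[r /andP[en _]].
  by rewrite (Hz t r en) x0 take0.
case/existsP: xy => t /existsP[r /andP[en]].
(* While the word is unfinished the configuration is unchanged, so the run for [y] serves for [x] as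
   well, and the letter emitted at [x] is the last one of the prefix for [y]. *)
case: ifP => [lt_l /andP[/andP[/eqP eq_k /eqP eq_l] /eqP eq_v]|ge_l].
  have [cs [z [rz Hz _]]] : exists cs z, [/\ run M w (y.2.1.1, position y.1 y.2.1.2) cs z,
    forall t r, enabled Y t r y.2.1.1 y.1 y.2.1.2 ->
      z = take y.2.2 (word t r) ++ pmap eout (y :: p) &
    y.2.2 = 0 :> nat -> z = pmap eout (y :: p)].
    by apply: IH => //; rewrite eq_k eq_v.
  exists cs, z; rewrite eq_k eq_v in rz; split=> // t' r' en'.
  have [<- <-] := enabled_uniq en en'.
  rewrite (Hz t r) ?eq_k ?eq_v // eq_l [in RHS]/= (vertex_out_enabled en).
  have : isSome (onth (word t r) x.2.2) by rewrite onthTE.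
  case wl: (onth _ _) => [a|//] _ /=.
  by rewrite (take_nth a) // (_ : nth a _ _ = a) ?cat_rcons //; apply: onth_nth.
(* With the word finished, this edge is a machine step, and [y] starts with counter 0. *)
case/andP=> /andP[/eqP eq_q /eqP eq_l] /(head_move_sound vx)[vy mv].
have [cs [z [rz _ /(_ eq_l) Hz]]] := IH y vy yp fp.
exists ((x.2.1.1, position x.1 x.2.1.2) :: cs), (word t r ++ z); split.
  apply: run_step rz; have /andP[/chosen_state eq_p _] := en.
  rewrite -eq_p; apply: enabled_step => //; first by rewrite eq_p.
move=> t' r' en'; have [<- <-] := enabled_uniq en en'.
rewrite [in RHS]/= (vertex_out_enabled en) onth_default /= 1?leqNgt ?ge_l // Hz.
by rewrite take_oversize // leqNgt ge_l.
Qed.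

End WithStrategy.

(** * From computations to strategies and their paths *)

Definition follows (s : gQ M * nat -> option (index_ins M)) t (r : bool)
    (c c' : config M) : Prop :=
  [/\ s c = Some t, i_p (ins t) = c.1, (scan w c.2 = i_sym (ins t)) <-> r,
      c'.1 = target t r & move (size w) c.2 (heading t r) c'.2].

Inductive strategy_run s : config M -> seq (config M) -> seq S2 -> Prop :=
| strategy_run_end c : c.1 = gqf M -> strategy_run s c [:: c] [::]
| strategy_run_step t (r : bool) c c' cs z : follows s t r c c' -> strategy_run s c' cs z ->
    strategy_run s c (c :: cs) (word t r ++ z).

Lemma strategy_run_ext s s' c cs z : strategy_run s c cs z ->
  (forall d, d \in (cs : seq (gQ M * nat)) -> s' d = s d) -> strategy_run s' c cs z.
Proof.
elim=> {c cs z} [c cf _|t r c c' cs z [sc ? ? ? ?] _ IH eq_s]; first exact: strategy_run_end.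
apply: (@strategy_run_step _ t r _ c').
  by split=> //; rewrite eq_s ?mem_head.
by apply: IH => d d_cs; rewrite eq_s // inE d_cs orbT.
Qed.

(** The strategy is built from the end of the run: setting its value at [c] does not disturb the
    rest, because [c] does not occur there. *)
Lemma simple_run_strategy c cs z : run M w c cs z -> uniq (cs : seq (gQ M * nat)) ->
  exists s, strategy_run s c cs z.
Proof.
elim=> {c cs z} [c cf _|c c' alpha cs z [i /In_ins[t <-] [pt st]] _ IH].
  by exists (fun _ => None); apply: strategy_run_end.
rewrite cons_uniq => /andP[c_cs /IH[s rs]].
exists (fun d => if d == c then Some t else s d).
have {}rs : strategy_run (fun d => if d == c then Some t else s d) c' cs z.
  apply: strategy_run_ext rs _ => d d_cs.
  by case: eqP => // eq_dc; rewrite -eq_dc d_cs in c_cs.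
case: st => -[sc [tgt [-> mv]]].
  by apply: (@strategy_run_step _ t true _ c' cs z _ rs); split; rewrite ?eqxx.
by apply: (@strategy_run_step _ t false _ c' cs z _ rs); split; rewrite ?eqxx //; split.
Qed.

Section StrategyPath.
Variable s : gQ M * nat -> option (index_ins M).

Definition strategy_sets (t : index_ins M) (b : bool) : {set gV g} :=
  [set v | s (i_p (ins t), position v b) == Some t].
Notation estep := (vertex_step strategy_sets).
Notation eout := (vertex_out strategy_sets).

(** As [s] is a function, the sets derived from it propose only [t] for this state and position,
    which is what [chosen] demands. *)
Lemma follows_enabled t r c c' v b : follows s t r c c' -> valid v b -> position v b = c.2 ->
  enabled strategy_sets t r c.1 v b.
Proof.
move=> [sc pt rd _ _] vb posv; apply/andP; split.
  apply/forallP => t'; apply/eqP; rewrite inE posv.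
  case: (eqVneq (i_p (ins t')) c.1) => [->|neq] /=.
    by rewrite -surjective_pairing sc; rewrite eq_sym.
  by symmetry; apply: contraNF neq => /eqP->; rewrite pt.
apply/eqP; apply/idP/idP => [/(tape_readP _ vb)|/rd rd'].
  by rewrite posv => /rd.
by apply/(tape_readP _ vb); rewrite posv.
Qed.

(** Induction on the number of letters still to be written; after the last one, the head move leads
    into [y]. *)
Lemma word_path t r q v b (y : gV g * copy M) p :
  enabled strategy_sets t r q v b -> path estep y p -> y.2.2 = 0 :> nat ->
  y.2.1.1 = target t r -> head_move (heading t r) v b y.1 y.2.1.2 ->
  forall l : 'I_(output_bound M).+1, l <= size (word t r) ->
  exists p', [/\ path estep (v, (q, b, l)) p', last (v, (q, b, l)) p' = last y p &
    pmap eout ((v, (q, b, l)) :: p') = drop l (word t r) ++ pmap eout (y :: p)].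
Proof.
move=> en yp y0 yq mv l le_l.
have [n] := ubnP (size (word t r) - l); elim: n l le_l => // n IH l le_l.
rewrite ltnS => le_n.
have outl : eout (v, (q, b, l)) = onth (word t r) l by apply: vertex_out_enabled.
case: (ltnP l (size (word t r))) => [lt_l|ge_l]; last first.
  exists (y :: p); split=> //.
    rewrite /= yp andbT; apply/existsP; exists t; apply/existsP; exists r.
    by rewrite en /= ltnNge ge_l /= yq y0 !eqxx.
  by rewrite [LHS]/= outl onth_default // drop_oversize.
(* The counter ranges up to [output_bound M] inclusive, so it can still be increased. *)
have lt_l1 : l.+1 < (output_bound M).+1 by rewrite ltnS (leq_trans lt_l) ?size_word.
have [||p' [p'p p'l p'z]] := IH (Ordinal lt_l1) => //=.
  by apply: leq_trans le_n; rewrite ltn_sub2l.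
exists ((v, (q, b, Ordinal lt_l1)) :: p'); split=> //.
  rewrite /= p'p andbT; apply/existsP; exists t; apply/existsP; exists r.
  by rewrite en /= lt_l !eqxx.
have : isSome (onth (word t r) l) by rewrite onthTE.
case wl: (onth _ _) => [a|//] _.
transitivity (a :: pmap eout ((v, (q, b, Ordinal lt_l1)) :: p')).
  by rewrite [LHS]/= outl wl.
by rewrite p'z [in RHS](drop_nth a) // (_ : nth a _ _ = a) //; apply: onth_nth.
Qed.

Lemma strategy_run_path c cs z : strategy_run s c cs z ->
  forall v b, valid v b -> position v b = c.2 ->
  exists p, [/\ path estep (v, copy0 c.1 b) p, vertex_final (last (v, copy0 c.1 b) p) &
    pmap eout ((v, copy0 c.1 b) :: p) = z].
Proof.
elim=> {c cs z} [c cf|t r c c' cs z fol _ IH] v b vb posv.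
  have fc : vertex_final (v, copy0 c.1 b) by apply/eqP.
  by exists [::]; split=> //=; rewrite vertex_final_out.
have en := follows_enabled fol vb posv.
have [_ _ _ tgt mv] := fol.
have [v' [b' [vb' posv']]] : exists v' b', valid v' b' /\ position v' b' = c'.2.
  by apply: position_at; case: mv.
have [p [pp fp zp]] := IH v' b' vb' posv'.
have hm : head_move (heading t r) v b v' b'.
  by apply: head_move_complete => //; rewrite posv posv'.
have [p' [p'p p'l p'z]] := word_path en pp erefl tgt hm (l := ord0) (leq0n _).
exists p'; split=> //; first by rewrite p'l.
by rewrite p'z drop0 zp.
Qed.

End StrategyPath.

End Simulation.

(** * The mso transducer *)

Section StringGraphs.
Variable A : finType.
Notation formula := (mso unit A).

Definition fFunctional : formula :=
  MBigAnd (fun a : A => MBigAnd (fun a' : A => MAllN 0 (MAllN 1 (MAllN 2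
    (MNot (MAnd (MAnd (MEdge _ a 0 1) (MEdge _ a' 0 2))
                (MNot (MAnd (MBool _ _ (a == a')) (MEq _ _ 1 2))))))))).

Definition fSucc (_ _ : unit) (x y : nat) : formula :=
  MBigOr (fun a : A => MEdge _ a x y).

(* In a functional graph whose vertices are all reachable from [x], a dead end [y]
   makes the graph a path from [x] to [y]. *)
Definition fString : formula :=
  MAnd fFunctional (MExN 0 (MExN 1 (MAnd (fLast A 1)
    (MAllN 2 (MReach 0 fSucc tt tt 0 2))))).

Variable g : graph unit A.
Implicit Types (nu : nat -> option (gV g)) (rho : nat -> {set gV g}) (u v : gV g).

Definition functional_graph : Prop :=
  forall a a' u v v', gE g u a v -> gE g u a' v' -> a = a' /\ v = v'.

Definition succ : rel (gV g * unit) := fun x y => [exists a, gE g x.1 a y.1].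

Lemma sat_fFunctional nu rho : sat nu rho fFunctional <-> functional_graph.
Proof.
have body a a' u v v' :
  sat (upd (upd (upd nu 0 u) 1 v) 2 v') rho
    (MNot (MAnd (MAnd (MEdge _ a 0 1) (MEdge _ a' 0 2))
                (MNot (MAnd (MBool _ _ (a == a')) (MEq _ _ 1 2)))))
  = (gE g u a v && gE g u a' v' ==> (a == a') && (v == v')).
  rewrite sat_MNot !sat_MAnd sat_MNot sat_MAnd sat_MBool.
  rewrite (sat_MEdge _ _ (u := u) (v := v)) // (sat_MEdge _ _ (u := u) (v := v')) //.
  by rewrite (sat_MEq _ (u := v) (v := v')) // negb_and negbK implybE.
split=> [|fg].
  rewrite sat_MBigAnd => /forallP fg a a' u v v' uv uv'.
  move/(_ a): fg; rewrite sat_MBigAnd => /forallP/(_ a').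
  rewrite sat_MAllN => /forallP/(_ u); rewrite sat_MAllN => /forallP/(_ v).
  rewrite sat_MAllN => /forallP/(_ v'); rewrite body uv uv' /=.
  by case/andP=> /eqP-> /eqP->.
rewrite sat_MBigAnd; apply/forallP => a; rewrite sat_MBigAnd; apply/forallP => a'.
rewrite sat_MAllN; apply/forallP => u; rewrite sat_MAllN; apply/forallP => v.
rewrite sat_MAllN; apply/forallP => v'; rewrite body.
by apply/implyP=> /andP[/fg + /[dup] uv'] => /(_ _ _ uv')[-> ->]; rewrite !eqxx.
Qed.

Lemma sat_fString nu rho : sat nu rho fString <->
  functional_graph /\ exists x y : gV g, last_node y /\ forall v, connect succ (x, tt) (v, tt).
Proof.
have reachE nu' x y u v : nu' x = Some u -> nu' y = Some v ->
    sat nu' rho (MReach 0 fSucc tt tt x y) = connect succ (u, tt) (v, tt).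
  apply: sat_MReach => rho' nu'' x' y' u' v' [] [] _ xu yv.
  by rewrite sat_MBigOr; apply: eq_existsb => a; rewrite (sat_MEdge _ _ xu yv).
rewrite sat_MAnd; split=> [/andP[/sat_fFunctional fg]|[fg [x [y [lasty conn]]]]].
  rewrite sat_MExN => /existsP[x]; rewrite sat_MExN => /existsP[y].
  rewrite sat_MAnd (sat_fLast _ (u := y)) // sat_MAllN => /andP[lasty /forallP conn].
  by split=> //; exists x, y; split=> // v; move/(_ v): conn; rewrite (reachE _ _ _ x v).
apply/andP; split; first exact/sat_fFunctional.
rewrite sat_MExN; apply/existsP; exists x; rewrite sat_MExN; apply/existsP; exists y.
rewrite sat_MAnd (sat_fLast _ (u := y)) // sat_MAllN lasty; apply/forallP => v.
by rewrite (reachE _ _ _ x v).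
Qed.

(** The trace lemma is reused with edge labels as emitted letters and dead ends as final vertices;
    every node is then an output vertex. The [unit] component is the single copy expected by
    [MReach]. *)
Lemma string_graph_iso (x y : gV g) : functional_graph -> last_node y ->
  (forall v, connect succ (x, tt) (v, tt)) -> exists w, graph_iso g (ed w).
Proof.
move=> fg lasty conn.
pose em (p : gV g * unit) := [pick a | [exists v, gE g p.1 a v]].
pose fin (p : gV g * unit) := last_node p.1.
have emE u a v : gE g u a v -> em (u, tt) = Some a.
  move=> uav; rewrite /em; case: pickP => [a' /existsP[v' /(fg _ _ _ _ _ uav)[->]]|/(_ a)] //.
  by move/existsP=> []; exists v.
have succ_det p q q' : succ p q -> succ p q' -> q = q'.
  case: p q q' => u [] [v []] [v' []] /existsP[a uv] /existsP[a' uv'].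
  by have [_ /= ->] := fg _ _ _ _ _ uv uv'.
have fin_stop p q : fin p -> ~~ succ p q.
  move=> fp; apply: contra fp => /existsP[a pq]; apply/existsP; exists a.
  by apply/existsP; exists q.1.
have fin_em p : fin p -> em p = None.
  by move=> fp; rewrite /em; case: pickP => // a pa; case/existsP: fp; exists a.
have /connectP[p xp lastp] := conn y.
exists (pmap em ((x, tt) :: p)).
apply: (@trace_graph_iso _ _ _ _ _ succ_det fin_stop fin_em _ (fun v => (v, tt))) => //.
- by rewrite -lastp.
- by move=> u v [].
- case=> u []; split=> [_|_]; last by exists u.
  rewrite conn /out_vertex /fin /em /last_node /=; case: pickP => [a _|none].
    by rewrite orbT.
  by rewrite orbF; apply/existsPn => a; apply/negbT/none.
move=> u a v; apply/idP/andP => [uav|[/eqP em_u /existsP[[d []] /andP[ud dv]]]].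
  rewrite (emE _ _ _ uav); split=> //; apply/existsP; exists (v, tt).
  by rewrite connect0 andbT; apply/existsP; exists a.
(* A vertex with a successor emits that edge's label, so the silent chain from [d] has length
   zero. *)
have {dv} eq_dv : d = v.
  case/connectP: dv => -[|q p'] /=; first by move=> _ [].
  case/andP=> /andP[/existsP[a' dq]].
  by rewrite (emE _ _ _ dq).
case/existsP: ud => a' /=; rewrite eq_dv => ua'v.
by move: em_u; rewrite (emE _ _ _ ua'v) => -[<-].
Qed.

Lemma iso_string_graph w : graph_iso g (ed w) ->
  functional_graph /\ exists x y : gV g, last_node y /\ forall v, connect succ (x, tt) (v, tt).
Proof.
case=> f [f_bij [_ f_edge']].
have f_edge u a v : gE g u a v = (onth w (f u) == Some a) && (f v == (f u).+1 :> nat).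
  by rewrite -f_edge' ed_edgeE.
split.
  move=> a a' u v v'; rewrite !f_edge => /andP[/eqP-> /eqP fv] /andP[/eqP[->] /eqP fv'].
  by split=> //; apply: (node_inj f_bij); rewrite fv.
have [x fx] := node_at f_bij (leq0n _).
have [y fy] := node_at f_bij (leqnn _).
exists x, y; split; first by rewrite (last_nodeE f_bij f_edge) fy.
move=> v; have [n] := ubnPeq (f v : nat).
elim: n v => [|n IH] v /eqP fv.
  by rewrite (node_inj f_bij (_ : f v = f x :> nat)) ?connect0 // fv fx.
have [u fu] : exists u, f u = n :> nat.
  by apply: (node_at f_bij); rewrite ltnW // -fv node_le.
apply: connect_trans (IH u _) (connect1 _); first by rewrite fu.
by rewrite /succ (some_edgeE f_edge) fv fu.
Qed.

(** [NMSO_ed] speaks about all input graphs, so the domain formula has to reject those that are not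
    of the form [ed w]. *)
Lemma fStringP nu rho : sat nu rho fString <-> exists w, graph_iso g (ed w).
Proof.
split=> [/sat_fString[fg [x [y []]]]|[w /iso_string_graph]]; first exact: string_graph_iso.
by move/sat_fString.
Qed.

End StringGraphs.

(** * The transducer of a 2gsm and its correctness *)

Section Transducer.
Variables (S1 S2 : finType) (M : gsm S1 S2).

Definition fReach0 (k : copy M) (x y : nat) : mso unit S1 :=
  MReach (n_codes M) (@fStep _ _ M) (copy0 (gqin M) false) k x y.

Definition fFinal (k : copy M) : mso unit S1 := MBool _ _ (k.1.1 == gqf M).

(** The domain formula accepts a parameter assignment when the path from the initial vertex reaches
    the final state. Node formulas test reachability themselves, so the edge formulas, applied only
    between output nodes, can leave it out. *)
Definition transducer : msot unit S1 unit S2 := {|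
  mC := copy M;
  mdom := MAnd (fString S1) (MExN 0 (MAnd (fRead (LEnd : tape_sym S1) false 0)
    (MBigOr (fun k : copy M => MAnd (fFinal k) (MExN 1 (fReach0 k 0 1))))));
  mnode := fun k _ => MExN 1 (MAnd (fRead (LEnd : tape_sym S1) false 1)
    (MAnd (fReach0 k 1 0) (MOr (fFinal k) (MBigOr (fun a => fEmits k a 0)))));
  medge := fun k1 k2 a => MAnd (fEmits k1 a 0)
    (MBigOr (fun k3 : copy M => MExN 2 (MAnd (fStep k1 k3 0 2)
       (MReach (n_codes M) (@fSilent _ _ M) k3 k2 2 1)))) |}.

Section Output.
Variables (g : graph unit S1) (Y : index_ins M -> bool -> {set gV g}).
Variables (rho : nat -> {set gV g}) (w : seq S1) (f : gV g -> 'I_(size w).+1).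
Hypotheses (rhoY : forall t b, rho (code t b) = Y t b) (f_bij : bijective f).
Hypothesis f_edge : forall u a v,
  gE g u a v = (onth w (f u) == Some a) && (f v == (f u).+1 :> nat).
Variable v0 : gV g.
Hypothesis fv0 : f v0 = 0 :> nat.
Let x0 : gV g * copy M := (v0, copy0 (gqin M) false).

Lemma sat_initial nu x u : nu x = Some u ->
  sat nu rho (fRead (LEnd : tape_sym S1) false x) = (u == v0).
Proof.
move=> xu; rewrite (sat_fRead _ _ _ xu).
apply/idP/eqP => [/(tape_readP f_bij f_edge _ (isT : valid f u false))|->].
  rewrite /position; case fu: (nat_of_ord (f u)) => [|n].
    by move=> _; apply: (node_inj f_bij); rewrite fu.
  by rewrite scanS; case: (onth w n).
by apply/(tape_readP f_bij f_edge _ (isT : valid f v0 false)); rewrite /position fv0.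
Qed.

Lemma sat_mdom nu : sat nu rho (mdom transducer) <->
  exists2 y, vertex_final y & connect (vertex_step Y) x0 y.
Proof.
have gstr : sat nu rho (fString S1).
  apply/fStringP; exists w, f; split=> //; split=> [v|u a v]; first by case: (glab g v).
  by rewrite ed_edgeE f_edge.
rewrite sat_MAnd gstr sat_MExN; split=> [/existsP[v]|[[u k] fy conn]].
  rewrite sat_MAnd sat_MBigOr (sat_initial (u := v)) // => /andP[/eqP-> /existsP[k]].
  rewrite sat_MAnd sat_MBool sat_MExN => /andP[fk /existsP[u]].
  by rewrite (sat_reach_step _ _ rhoY (u := v0) (v := u)) // => conn; exists (u, k).
apply/existsP; exists v0; rewrite sat_MAnd sat_MBigOr (sat_initial (u := v0)) // eqxx.
apply/existsP; exists k; rewrite sat_MAnd sat_MBool (_ : _ == _) // sat_MExN.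
by apply/existsP; exists u; rewrite (sat_reach_step _ _ rhoY (u := v0) (v := u)).
Qed.

Lemma out_nodeE u (k : copy M) s : out_node (T := transducer) rho (u, k, s) =
  connect (vertex_step Y) x0 (u, k) && out_vertex (vertex_out Y) (@vertex_final _ _ M g) (u, k).
Proof.
have -> : out_node (T := transducer) rho (u, k, s)
    = sat (env1 u) rho (@mnode _ _ _ _ transducer k s).
  by apply/forallP/idP => [/(_ s)/eqP->|sk []] //; case: s sk => ->.
rewrite sat_MExN; apply/existsP/idP => [[v]|conn].
  rewrite sat_MAnd (sat_initial (u := v)) // sat_MAnd => /andP[/eqP-> /andP[]].
  rewrite (sat_reach_step _ _ rhoY (u := v0) (v := u)) // => ->.
  rewrite andTb sat_MOr sat_MBool sat_MBigOr /out_vertex vertex_outE => /orP[fk|].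
    by apply/orP; left.
  case/existsP=> a; rewrite (sat_fEmits _ _ rhoY (u := u)) // => em.
  by apply/orP; right; apply/existsP; exists a.
exists v0; rewrite sat_MAnd (sat_initial (u := v0)) // sat_MAnd eqxx.
rewrite (sat_reach_step _ _ rhoY (u := v0) (v := u)) //.
case/andP: conn => ->; rewrite !andTb sat_MOr sat_MBool sat_MBigOr /out_vertex vertex_outE.
case/orP=> [fk|/existsP[a em]]; apply/orP; first by left.
by right; apply/existsP; exists a; rewrite (sat_fEmits _ _ rhoY (u := u)).
Qed.

Lemma sat_medge u v k1 k2 a : sat (env2 u v) rho (@medge _ _ _ _ transducer k1 k2 a) =
  out_edge (vertex_step Y) (vertex_out Y) (u, k1) a (v, k2).
Proof.
rewrite sat_MAnd (sat_fEmits _ _ rhoY (u := u)) // /out_edge vertex_outP; congr andb.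
rewrite sat_MBigOr; apply/existsP/existsP => [[k3]|[[d k3] /andP[ud dv]]].
  rewrite sat_MExN => /existsP[d]; rewrite sat_MAnd (sat_fStep _ _ rhoY (u := u) (v := d)) //.
  by rewrite (sat_reach_silent _ _ rhoY (u := d) (v := v)) // => ?; exists (d, k3).
exists k3; rewrite sat_MExN; apply/existsP; exists d.
rewrite sat_MAnd (sat_fStep _ _ rhoY (u := u) (v := d)) // ud.
by rewrite (sat_reach_silent _ _ rhoY (u := d) (v := v)).
Qed.

Lemma out_graph_iso p : path (vertex_step Y) x0 p -> vertex_final (last x0 p) ->
  graph_iso (out_graph transducer rho) (ed (pmap (vertex_out Y) (x0 :: p))).
Proof.
move=> pp fp.
pose phi (q : gV (out_graph transducer rho)) : gV g * copy M := (val q).1.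
apply: (trace_graph_iso (vertex_step_det f_bij f_edge (Y := Y))
  (@vertex_final_stop _ _ _ _ Y) (@vertex_final_out _ _ _ _ Y) (phi := phi)) => //.
- by move=> [[[u k] []] q] [[[u' k'] []] q'] /= [eu ek]; apply: val_inj; rewrite /= eu ek.
- case=> u k; rewrite -(out_nodeE u k tt); split=> [[[[[u' k'] []] q] /= [<- <-]] //|q].
  by exists (exist _ (u, k, tt) q).
move=> [[[u k] s] q] a [[[u' k'] s'] q'].
exact: sat_medge.
Qed.

End Output.

(** An accepted assignment yields a path and hence a computation. Conversely, the bound on outputs
    provides a repetition-free computation, whose strategy is encoded in the parameters. *)
Lemma transducerP (g : graph unit S1) (h : graph unit S2) :
  (forall w, exists B, forall z, gsm_rel M w z -> size z <= B) ->
  msot_rel transducer g h <->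
    exists w z, gsm_rel M w z /\ graph_iso g (ed w) /\ graph_iso h (ed z).
Proof.
move=> bnd; split=> [[rho [domr iso_h]]|[w [z [wz [iso_g iso_h]]]]].
  have [w iso_g] : exists w, graph_iso g (ed w).
    by move: domr; rewrite sat_MAnd => /andP[/fStringP].
  have [f [f_bij [_ f_edge']]] := iso_g.
  have f_edge u a v : gE g u a v = (onth w (f u) == Some a) && (f v == (f u).+1 :> nat).
    by rewrite -f_edge' ed_edgeE.
  have [v0 fv0] := node_at f_bij (leq0n _).
  pose Y (t : index_ins M) b := rho (code t b).
  have rhoY t b : rho (code t b) = Y t b by [].
  case/(sat_mdom rhoY f_bij f_edge fv0): domr => y fy /connectP[p pp eq_y].
  rewrite eq_y in fy.
  exists w, (pmap (vertex_out Y) ((v0, copy0 (gqin M) false) :: p)); split; last first.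
    split=> //; apply: graph_iso_trans (graph_iso_sym iso_h) _.
    exact: (out_graph_iso rhoY f_bij f_edge fv0 pp fy).
  have [cs [z [rz _ /(_ erefl) <-]]] :=
    path_run f_bij f_edge (x := (v0, copy0 (gqin M) false)) isT pp fy.
  by exists cs; move: rz; rewrite /position /= fv0.
have [f [f_bij [_ f_edge']]] := iso_g.
have f_edge u a v : gE g u a v = (onth w (f u) == Some a) && (f v == (f u).+1 :> nat).
  by rewrite -f_edge' ed_edgeE.
have [v0 fv0] := node_at f_bij (leq0n _).
have [B bndw] := bnd w.
have [cs [rz ucs]] := bounded_simple_run bndw wz.
have [s srun] := simple_run_strategy rz ucs.
have [p [pp fp zp]] := strategy_run_path f_bij f_edge srun (isT : valid f v0 false) fv0.
set Y := strategy_sets f s in pp zp.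
(* Since [code] is injective, each variable below [n_codes] receives its own set; the others get the
   arbitrary value [set0]. *)
pose rho n := if [pick tb : index_ins M * bool | code tb.1 tb.2 == n] is Some tb
              then Y tb.1 tb.2 else set0.
have rhoY t b : rho (code t b) = Y t b.
  rewrite /rho; case: pickP => [[t' b'] /eqP/val_inj/enum_rank_inj[-> ->]//|/(_ (t, b))].
  by rewrite eqxx.
exists rho; split.
  apply/(sat_mdom rhoY f_bij f_edge fv0).
  by exists (last (v0, copy0 (gqin M) false) p) => //; apply/connectP; exists p.
apply: graph_iso_trans (graph_iso_sym iso_h); rewrite -zp.
exact: (out_graph_iso rhoY f_bij f_edge fv0 pp fp).
Qed.

End Transducer.

(** Output nodes are triples of an input node, a copy and a label from [unit]. This caps their
    number, which is [size z + 1], whatever the parameters are. *)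
Lemma NMSO_ed_bounded (S1 S2 : finType) (m : transduction S1 S2) : NMSO_ed m ->
  forall w, exists B, forall z, m w z -> size z <= B.
Proof.
case=> T TP w; exists ((size w).+1 * #|mC T| * 1) => z wz.
have iso_refl (A : eqType) (s : seq A) : graph_iso (ed s) (ed s).
  by exists id; split; first by exists id.
have [rho [_ [f [f_bij _]]]] : msot_rel T (ed w) (ed z).
  by apply/TP; exists w, z.
apply: ltnW; have := bij_eq_card f_bij; rewrite card_ord => <-.
rewrite -[X in _ * X]card_unit -{1}[(size w).+1]card_ord -!card_prod.
exact: leq_card val_inj.
Qed.

Theorem theorem6p6 (S1 S2 : finType) (m : transduction S1 S2) :
  (NGSM m /\ NMSO_ed m) <-> NGSM_fv m.
Proof.
split=> [[[M mM] /NMSO_ed_bounded bnd]|[M [fv mM]]].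
  exists M; split=> //; exists #|gQ M| => w z wz.
  have [B bndw] := bnd w.
  have [|cs [r ucs]] := bounded_simple_run (B := B) _ wz; first by move=> z' /mM/bndw.
  by exists cs; split=> //; apply: uniq_k_visiting.
split; first by exists M.
exists (transducer M) => g h.
have := transducerP g h (fun w => finite_visit_bounded w fv) => ->.
by split=> -[w [z [/mM wz isos]]]; exists w, z.
Qed.
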